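(* Let $n\ge 1$. The type $C_n$ zeta map $\zeta_C:\mathcal L_{n,n}\to\mathcal B_{2n}$ is a bijection.
   Context: For $a,b\ge 0$, $\mathcal L_{a,b}$ is the set of words in the letters $N$ (North step) and $E$ (East step) containing exactly $a$ letters $E$ and $b$ letters $N$. $\mathcal B_m$ is the set of words of length $m$ in $\{N,E\}$ such that every prefix contains at least as many $N$'s as $E$'s (ballot paths). For an integer vector $a=(a_1,\dots,a_n)$ and an integer $j\ge0$ define words in $\{N,E\}$: $\overrightarrow{S}^+_j(a)$ is obtained by reading $a_1,a_2,\dots,a_n$ from left to right, writing $N$ for each entry equal to $j$ and $E$ for each entry equal to $j+1$ (other entries are ignored); $\overleftarrow{S}^+_j(a)$ is defined the same way but reading $a$ from right to left; $\overrightarrow{S}^-_j(a)$ (resp. $\overleftarrow{S}^-_j(a)$) is obtained by reading $a$ from left to right (resp. right to left), writing $N$ for each entry equal to $-j$ and $E$ for each entry equal to $-j-1$. For $\pi\in\mathcal L_{n,n}$ let $\lambda_i$ be the number of East steps of $\pi$ preceding its $i$-th North step ($1\le i\le n$), and define the type $C_n$ area vector $\mu=(\mu_1,\dots,\mu_n)$ by $\mu_i=(n+1-i)-\lambda_{n+1-i}$. Then $\zeta_C(\pi)$ is the concatenation $\overleftarrow{S}^-_n(\mu)\overrightarrow{S}^+_n(\mu)\overleftarrow{S}^-_{n-1}(\mu)\overrightarrow{S}^+_{n-1}(\mu)\cdots\overleftarrow{S}^-_0(\mu)\overrightarrow{S}^+_0(\mu)$. *)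

(* Defs.v *)
From HB Require Import structures.
From mathcomp Require Import all_boot all_order all_algebra.
From mathcomp Require Import classical_sets functions.
Set Implicit Arguments.
Unset Strict Implicit.
Unset Printing Implicit Defensive.

Import GRing.Theory.

Variant step := North | East.

Definition bool_of_step (s : step) : bool := if s is North then true else false.
Definition step_of_bool (b : bool) : step := if b then North else East.
Lemma bool_of_stepK : cancel bool_of_step step_of_bool.
Proof. by case. Qed.
HB.instance Definition _ := Finite.copy step (can_type bool_of_stepK).

Definition word := seq step.

Definition lattice_paths (a b : nat) : set word :=
  [set w | count_mem East w = a /\ count_mem North w = b]%classic.

Definition ballot_paths (m : nat) : set word :=
  [set w | size w = m /\
     forall p, prefix p w -> count_mem East p <= count_mem North p]%classic.

Definition north_positions (w : word) : seq nat :=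
  [seq k <- iota 0 (size w) | nth East w k == North].

(* The index [i] is 1-based, as in lambda_1, ..., lambda_n; [path_lambda w i]
   is meaningful only for 1 <= i <= count_mem North w. *)
Definition path_lambda (w : word) (i : nat) : nat :=
  count_mem East (take (nth 0 (north_positions w) i.-1) w).

(* [iota 1 n] enumerates i = 1, ..., n, so the truncated subtraction
   [n.+1 - i] is exact. *)
Definition area_vector (n : nat) (w : word) : seq int :=
  [seq ((n.+1 - i)%:Z - (path_lambda w (n.+1 - i))%:Z)%R | i <- iota 1 n].

(* Reads [a] from left to right, writing North for each entry [x] and East for
   each entry [y]. *)
Definition reading_word (x y : int) (a : seq int) : word :=
  pmap (fun z => if z == x then Some North
                 else if z == y then Some East else None) a.

Definition Splus_right (j : nat) (a : seq int) : word :=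
  reading_word j%:Z (j%:Z + 1)%R a.

Definition Sminus_left (j : nat) (a : seq int) : word :=
  reading_word (- j%:Z)%R (- j%:Z - 1)%R (rev a).

Definition zetaC (n : nat) (w : word) : word :=
  let mu := area_vector n w in
  flatten [seq Sminus_left j mu ++ Splus_right j mu | j <- rev (iota 0 n.+1)].

(* Main.v *)
(** Reversed, the area vector of a path lists its heights after the North steps,
    so it is a sequence a whose entries rise by at most one at a time, starting
    from 0 and ending at a nonnegative value. Let c_v be the number of entries v.

    Injectivity: zeta(a) has n - c_0 East steps, which gives c_0. Reversed,
    zeta(a) is a concatenation of readings
    S^+_0, S^-_0, S^+_1, S^-_1, ..., none of which, apart from the first, starts
    with E; hence a reading ends just before the North step following its last
    one, and is determined by its number of North steps. That number is c_0 for
    the first two, and the number of East steps two readings before for the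
    others. So all readings can be recovered, that is, the relative order of the
    entries v and v + 1 for every v, and this determines a.

    Surjectivity follows by counting: the ballot paths of length 2n are as many
    as the words with n letters E and n letters N. *)

Require Import Defs.
From mathcomp Require Import all_boot all_order all_algebra.
From mathcomp Require Import classical_sets functions.
From mathcomp Require Import zify.
Set Implicit Arguments.
Unset Strict Implicit.
Unset Printing Implicit Defensive.

Import Order.TTheory GRing.Theory.

Notation Ns := (count_mem North).
Notation Es := (count_mem East).

(** * Ballot paths and balanced paths are equinumerous *)

Fixpoint words (m : nat) : seq word :=
  if m is k.+1 then map (cons North) (words k) ++ map (cons East) (words k)
  else [:: [::]].

Lemma mem_words m w : (w \in words m) = (size w == m).
Proof.
have cons_inj (x : step) : injective (cons x) by move=> ? ? [].
have consN (x y : step) (v : word) s : x != y -> (x :: v \in map (cons y) s) = false.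
  by move=> xy; apply/mapP => -[u _ [e]]; rewrite e eqxx in xy.
elim: m w => [|m IH] [|x w] //=.
  by rewrite mem_cat; apply/norP; split; apply/mapP => -[].
by case: x; rewrite mem_cat (mem_map (@cons_inj _)) IH consN ?orbF //= eqSS.
Qed.

Lemma uniq_words m : uniq (words m).
Proof.
elim: m => //= m IH; rewrite cat_uniq !map_inj_uniq ?IH /=; try by move=> ? ? [].
by rewrite andbT; apply/hasPn => w /mapP[u _ ->]; apply/mapP => -[].
Qed.

Fixpoint ballot_from (h : nat) (w : word) : bool :=
  match w with
  | [::] => true
  | North :: w' => ballot_from h.+1 w'
  | East :: w' => (0 < h) && ballot_from h.-1 w'
  end.

Lemma ballot_fromP h w :
  reflect (forall p, prefix p w -> Es p <= h + Ns p) (ballot_from h w).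
Proof.
elim: w h => [|x w IH] h.
  by apply: ReflectT => p; rewrite prefixs0 => /eqP ->.
case: x; rewrite [ballot_from _ _]/=.
  apply: (iffP (IH _)) => H p.
    by case: p => [|y p] //; rewrite prefix_cons => /andP[/eqP -> /H] /=; lia.
  by move=> pw; have := H (North :: p); rewrite prefix_cons eqxx pw => /(_ isT) /=; lia.
apply: (iffP andP) => [[h0 /IH H] [|y p] //|H].
  by rewrite prefix_cons => /andP[/eqP -> /H] /=; lia.
have h0 : 0 < h by have := H [:: East]; rewrite prefix_cons eqxx prefix0s => /(_ isT) /=; lia.
split=> //; apply/IH => p pw.
by have := H (East :: p); rewrite prefix_cons eqxx pw => /(_ isT) /=; lia.
Qed.

(* The words with final height in [-h, h + 1] satisfy the recursion in [h] of
   the ballot words starting at height [h]: removing a first letter gives the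
   ranges [-h - 1, h] and [-h + 1, h + 2], whose multiset union is that of
   [-(h + 1), h + 2] and [-(h - 1), h]. *)
Lemma count_ballot_from m h :
  count (ballot_from h) (words m) =
  count (fun w => (Es w <= Ns w + h) && (Ns w <= Es w + h.+1)) (words m).
Proof.
elim: m h => [|m IH] h //=; rewrite !count_cat !count_map.
rewrite (@eq_count _ (preim _ (ballot_from h)) (ballot_from h.+1)) // IH.
case: h => [|h].
  rewrite (@eq_count _ (preim _ (ballot_from 0)) pred0) // count_pred0 addn0.
  set s := words m.
  rewrite -[RHS]count_predUI [X in _ = _ + X](@eq_count _ _ pred0).
    by rewrite count_pred0 addn0; apply: eq_count => w /=; lia.
  by move=> w /=; lia.
rewrite (@eq_count _ (preim (cons East) (ballot_from _)) (ballot_from h)) // IH.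
by rewrite -[RHS]count_predUI; congr (_ + _); apply: eq_count => w /=; lia.
Qed.

Lemma size_word (w : word) : size w = Ns w + Es w.
Proof. by elim: w => [|[] w IH] //=; rewrite IH ?addnS. Qed.

Definition balanced_seq n := [seq w <- words (2 * n) | (Es w == n) && (Ns w == n)].
Definition ballot_seq n := [seq w <- words (2 * n) | ballot_from 0 w].

Lemma mem_balanced_seq n w : reflect (lattice_paths n n w) (w \in balanced_seq n).
Proof.
rewrite mem_filter mem_words size_word; apply: (iffP idP); rewrite /lattice_paths /=.
  by lia.
by move=> [-> ->]; lia.
Qed.

Lemma mem_ballot_seq n w : reflect (ballot_paths (2 * n) w) (w \in ballot_seq n).
Proof.
rewrite mem_filter mem_words; apply: (iffP andP).
  by move=> [/ballot_fromP H /eqP sw]; split.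
by move=> [/eqP sw H]; split=> //; apply/ballot_fromP.
Qed.

(** At [h = 0] the final height is 0 or 1; for words of even length it must be 0. *)
Lemma size_ballot_seq n : size (ballot_seq n) = size (balanced_seq n).
Proof.
rewrite !size_filter count_ballot_from; apply: eq_in_count => w.
by rewrite mem_words size_word; lia.
Qed.

(** * Heights of a lattice path *)

Local Open Scope ring_scope.

Fixpoint heights (h : int) (w : word) : seq int :=
  match w with
  | [::] => [::]
  | North :: w' => (h + 1) :: heights (h + 1) w'
  | East :: w' => heights (h - 1) w'
  end.

Lemma size_heights h w : size (heights h w) = Ns w.
Proof. by elim: w h => //= -[] w IH h /=; rewrite IH. Qed.

Lemma north_positions_cons x w :
  north_positions (x :: w) =
  (if x is North then [:: 0%N] else [::]) ++ map S (north_positions w).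
Proof.
rewrite /north_positions /= (iotaDl 1 0) filter_map.
by case: x.
Qed.

Lemma size_north_positions w : size (north_positions w) = Ns w.
Proof.
by elim: w => // x w IH; rewrite north_positions_cons size_cat size_map IH; case: x.
Qed.

Lemma heights_lambda h w :
  heights h w = [seq h + k%:Z - (path_lambda w k)%:Z | k <- iota 1 (Ns w)].
Proof.
rewrite (iotaDl 1 0) -map_comp.
elim: w h => [|x w IH] h //; case: x => /=; rewrite /path_lambda north_positions_cons /=.
  congr cons; first by lia.
  rewrite (iotaDl 1 0) -map_comp IH; apply/eq_in_map => i; rewrite mem_iota => /andP[_ hi].
  by rewrite /path_lambda /= (nth_map 0%N) ?size_north_positions //=; lia.
rewrite IH; apply/eq_in_map => i; rewrite mem_iota => /andP[_ hi].
by rewrite /path_lambda /= (nth_map 0%N) ?size_north_positions //=; lia.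
Qed.

Lemma area_vectorE w : area_vector (Ns w) w = rev (heights 0 w).
Proof.
rewrite /area_vector heights_lambda -map_rev; set n := Ns w.
have -> : rev (iota 1 n) = [seq (n.+1 - i)%N | i <- iota 1 n].
  apply: (@eq_from_nth _ 0%N) => [|i]; first by rewrite size_rev size_map.
  rewrite size_rev size_iota => hi.
  by rewrite nth_rev ?size_iota // (nth_map 0%N) ?size_iota // !nth_iota //; lia.
by rewrite -map_comp; apply: eq_map => i /=; rewrite add0r.
Qed.

Definition rise1 : rel int := fun x y => y <= x + 1.

Lemma path_heights (x h : int) w : h <= x -> path rise1 x (heights h w).
Proof.
elim: w x h => //= -[] w IH x h hx /=; last by apply: IH; lia.
by rewrite IH // /rise1 andbT; lia.
Qed.

(** A list starting with [h + 1] forces a first letter North, since after East the list starts at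
    [h] or lower. The count of East steps settles what follows the last North step. *)
Lemma heights_inj h w w' :
  Es w = Es w' -> heights h w = heights h w' -> w = w'.
Proof.
have low u v k : heights k u <> k + 2 :: v.
  move=> e; have := path_heights u (lexx k).
  by rewrite e /= /rise1; lia.
elim: w w' h => [|x w IH] [|x' w'] h //; [by case: x'|by case: x|].
case: x; case: x' => /=.
- by rewrite !add0n => /IH e [/e ->].
- by move=> _ e; case: (low w' (heights (h + 1) w) (h - 1)); rewrite -e; congr cons; lia.
- by move=> _ e; case: (low w (heights (h + 1) w') (h - 1)); rewrite e; congr cons; lia.
- by move=> /= [] /IH e /e ->.
Qed.

(** Only East steps follow the last North step, so the path ends no higher than there. *)
Lemma last_heights (x h : int) w : h <= x -> h - (Es w)%:Z <= last x (heights h w) - (Ns w)%:Z.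
Proof.
elim: w x h => [|[] w IH] x h hx /=; first by lia.
  by have /= := IH (h + 1) (h + 1) (lexx _); lia.
by have /IH /= : h - 1 <= x; lia.
Qed.

Lemma heights_bounds h w (v : int) :
  v \in heights h w -> h - (Es w)%:Z <= v <= h + (Ns w)%:Z.
Proof.
elim: w h => [|[] w IH] h //=; first by rewrite inE => /orP[/eqP ->|/IH] /=; lia.
by move=> /IH /=; lia.
Qed.

(** * Readings *)

Lemma reading_word_cat x y a b :
  reading_word x y (a ++ b) = reading_word x y a ++ reading_word x y b.
Proof. exact: pmap_cat. Qed.

Lemma rev_reading_word x y a : rev (reading_word x y a) = reading_word x y (rev a).
Proof.
elim: a => //= z a IH; rewrite rev_cons -cats1 reading_word_cat -IH /=.
by case: ifP => _; [|case: ifP => _]; rewrite /= ?rev_cons ?cats1 ?cats0.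
Qed.

Lemma reading_word_opp x y a :
  reading_word (- x) (- y) a = reading_word x y (map -%R a).
Proof. by elim: a => //= z a ->; rewrite !eqr_oppLR. Qed.

Lemma Ns_reading_word x y a : Ns (reading_word x y a) = count_mem x a.
Proof. by elim: a => //= z a <-; case: ifP => _ //=; case: ifP. Qed.

Lemma Es_reading_word x y a : x != y -> Es (reading_word x y a) = count_mem y a.
Proof.
move=> xy; elim: a => //= z a <-; case: eqP => [->|_] /=; last by case: ifP.
by rewrite (negPf xy).
Qed.

(** Needed for minus readings, in which North marks the larger of two consecutive values. *)
Lemma reading_word_swap x y a b : x != y ->
  reading_word x y a = reading_word x y b -> reading_word y x a = reading_word y x b.
Proof.
move=> xy; pose sw s := if s is North then East else North.
suff E c : reading_word y x c = map sw (reading_word x y c) by rewrite !E => ->.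
elim: c => //= z c ->; case: (eqVneq z x) => [->|_]; first by rewrite (negPf xy).
by case: ifP.
Qed.

Definition startsE (w : word) := if w is East :: _ then true else false.

Lemma startsE_cat u v : ~~ startsE u -> ~~ startsE v -> ~~ startsE (u ++ v).
Proof. by case: u. Qed.

(** Rising by at most one from below [v], the sequence meets [v] before [v + 1]. *)
Lemma startsE_reading_word (x v : int) a :
  path rise1 x a -> x < v -> ~~ startsE (reading_word v (v + 1) a).
Proof.
elim: a x => //= y a IH x /andP[xy ya] xv; move: xy; rewrite /rise1 => xy.
case: eqP => // yv; case: eqP => [|_]; first by lia.
by apply: IH ya _; lia.
Qed.

(* If the heads differ, say [x < y], then [a] passes through [y - 1] before
   reaching [y], whereas [b] starts with [y]. *)
Lemma reading_word_inj x y a b :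
  path rise1 x a -> path rise1 y b ->
  (forall v, reading_word v (v + 1) a = reading_word v (v + 1) b) -> a = b.
Proof.
have aux u v c d : u < v -> path rise1 u c ->
    (forall t, reading_word t (t + 1) (u :: c) = reading_word t (t + 1) (v :: d)) -> False.
  move=> uv uc /(_ (v - 1)) e.
  have /(@startsE_reading_word _ (v - 1)) : path rise1 (u - 1) (u :: c).
    by rewrite /= uc /rise1 andbT; lia.
  have /[swap] /[apply] : u - 1 < v - 1 by lia.
  rewrite e /=; case: eqP => [|_]; first by lia.
  by rewrite subrK eqxx.
elim: a b x y => [|u a IH] [|v b] x y //.
- by move=> _ _ /(_ v) /=; rewrite eqxx.
- by move=> _ _ /(_ u) /=; rewrite eqxx.
move=> /= /andP[_ ua] /andP[_ vb] e.
case: (ltgtP u v) => uv; first by case: (aux _ _ _ _ uv ua e).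
  by case: (aux _ _ _ _ uv vb (fun t => esym (e t))).
rewrite -uv in vb e *; congr cons; apply: IH ua vb _ => t.
by have /= := e t; case: ifP => _; [case|case: ifP => _ //; case].
Qed.

(** * The zeta map in terms of heights *)

(** Here [a] is the reversed area vector, so the minus reading follows [a] and the plus reading
    [rev a]. *)
Definition zeta_block (j : nat) (a : seq int) : word :=
  reading_word (- j%:Z) (- j%:Z - 1) a ++ reading_word j%:Z (j%:Z + 1) (rev a).

Fixpoint zeta_blocks (k : nat) (a : seq int) : word :=
  if k is j.+1 then zeta_block j a ++ zeta_blocks j a else [::].

Lemma zetaC_heights n w : Ns w = n -> zetaC n w = zeta_blocks n.+1 (heights 0 w).
Proof.
move=> <-; rewrite /zetaC area_vectorE /Sminus_left /Splus_right revK.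
elim: (Ns w).+1 => // k IH.
by rewrite -[k.+1]addn1 iotaD rev_cat /= add0n IH addn1.
Qed.

Definition abs_count (j : nat) (a : seq int) := count (fun v => `|v|%N == j) a.

Lemma Es_zeta_block j a : Es (zeta_block j a) = abs_count j.+1 a.
Proof.
rewrite /zeta_block count_cat !Es_reading_word ?count_rev; try lia.
by elim: a => //= v a; rewrite /abs_count /=; lia.
Qed.

(** In block 0 both readings write North for each entry 0. *)
Lemma Ns_zeta_block j a :
  Ns (zeta_block j a) = (abs_count j a + (j == 0) * abs_count 0 a)%N.
Proof.
rewrite /zeta_block count_cat !Ns_reading_word count_rev.
by case: j => [|j]; elim: a => //= v a; rewrite /abs_count /=; lia.
Qed.

(** With at most [h] East steps, [u] stays nonnegative in whatever order its letters come. *)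
Lemma ballot_from_cat h u v : (Es u <= h)%N ->
  ballot_from h (u ++ v) = ballot_from (h + Ns u - Es u) v.
Proof.
elim: u h => [|[] u /= IH] h /= hu; first by rewrite addn0 subn0.
  by rewrite IH; [congr ballot_from|]; lia.
by rewrite IH; [have -> : (0 < h)%N by lia|]; [congr ballot_from|]; lia.
Qed.

(* Every East step of block [j] is matched with a North step of block
   [j + 1] coming from the same entry. *)
Lemma ballot_zeta_blocks k h a :
  (abs_count k a <= h)%N -> ballot_from h (zeta_blocks k a).
Proof.
elim: k h => [|k IH] h //= hk; rewrite ballot_from_cat ?Es_zeta_block //.
by apply: IH; rewrite Ns_zeta_block; lia.
Qed.

Lemma Es_zeta_blocks k a :
  (Es (zeta_blocks k a) + abs_count 0 a)%N = count (fun v => `|v| <= k)%N a.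
Proof.
elim: k => [|k IH] /=.
  by rewrite add0n; apply: eq_count => v /=; lia.
rewrite count_cat Es_zeta_block -addnA IH.
by elim: (a) => //= v s; rewrite /abs_count /=; lia.
Qed.

Lemma Ns_zeta_blocks k a :
  Ns (zeta_blocks k.+1 a) = (count (fun v => `|v| <= k)%N a + abs_count 0 a)%N.
Proof.
elim: k => [|k IH].
  rewrite /= cats0 Ns_zeta_block mul1n; congr addn.
  by apply: eq_count => v /=; lia.
rewrite -[zeta_blocks _ _]/(zeta_block k.+1 a ++ zeta_blocks k.+1 a).
rewrite count_cat IH Ns_zeta_block mul0n.
by elim: (a) => //= v s; rewrite /abs_count /=; lia.
Qed.

(** * Recovering the readings from the image *)

(** Both cuts fall just before the North step that follows the common number of North steps, or at
    the end of the word. *)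
Lemma cat_cancel_Ns (u v x y : word) :
  Ns u = Ns v -> ~~ startsE x -> ~~ startsE y -> u ++ x = v ++ y -> u = v /\ x = y.
Proof.
move=> + hx hy; elim: u v => [|s u IH] [|t v] //=.
- by case: t => //= _ e; rewrite e in hx.
- by case: s => //= _ e; rewrite -e in hy.
by move=> + [st]; rewrite st => /addnI /IH{}IH /IH [-> ->].
Qed.

(* The area vectors of paths that return to height 0, in reverse order. *)
Definition area_seq (a : seq int) := path rise1 0 a && (0 <= last 0 a).

Lemma startsE_Splus j a : area_seq a ->
  ~~ startsE (reading_word j.+1%:Z (j.+1%:Z + 1) a).
Proof. by move=> /andP[pa _]; apply: startsE_reading_word pa _. Qed.

(* Negating and reversing [a] preserves [rise1], which turns this reading into
   one covered by [startsE_reading_word]. *)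
Lemma startsE_Sminus j a : area_seq a ->
  ~~ startsE (reading_word (- j%:Z) (- j%:Z - 1) (rev a)).
Proof.
move=> /andP[pa la]; rewrite -opprD reading_word_opp.
(* The last entry of [a] is nonnegative, so its negation is at most 0, a rise of at most one from
   [-1]; and [-1 < j] even for [j = 0]. *)
apply: (@startsE_reading_word (-1)) => //.
case: (lastP a) pa la => // s z; rewrite last_rcons rev_rcons -rev_path => + z0.
rewrite last_rcons belast_rcons rev_cons => pa.
rewrite /= path_map; apply/andP; split; first by rewrite /rise1; lia.
move: pa; rewrite rcons_path => /andP[pa _].
by apply: sub_path pa => x y /=; rewrite /rise1; lia.
Qed.

Fixpoint zeta_tail (j k : nat) (a : seq int) : word :=
  if k is k'.+1 then rev (zeta_block j a) ++ zeta_tail j.+1 k' a else [::].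

Lemma rev_zeta_blocks k a : rev (zeta_blocks k a) = zeta_tail 0 k a.
Proof.
have tailS m j : zeta_tail j m.+1 a = zeta_tail j m a ++ rev (zeta_block (j + m)%N a).
  elim: m j => [|m IH] j; first by rewrite /= addn0 cats0.
  by rewrite -addSnnS [zeta_tail j m.+1 a]/= -catA -IH.
by elim: k => //= k IH; rewrite rev_cat IH -[in RHS](add0n k) -tailS.
Qed.

Lemma rev_zeta_block j a : rev (zeta_block j a) =
  reading_word j%:Z (j%:Z + 1) a ++ reading_word (- j%:Z) (- j%:Z - 1) (rev a).
Proof. by rewrite rev_cat !rev_reading_word revK. Qed.

(** Block 0 is excluded: its plus reading starts with East when [a] begins with 1. *)
Lemma startsE_zeta_tail j k a : area_seq a -> ~~ startsE (zeta_tail j.+1 k a).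
Proof.
move=> ha; elim: k j => // k IH j /=.
rewrite rev_zeta_block; apply: startsE_cat; last exact: IH.
by apply: startsE_cat; [apply: startsE_Splus | apply: startsE_Sminus].
Qed.

(** The counts of [j] and [-j] are the numbers of North steps that cut off the two readings of block
    [j]; the East steps of these readings give the counts for block [j + 1]. *)
Lemma zeta_tail_inj j k a b : area_seq a -> area_seq b ->
  count_mem j%:Z a = count_mem j%:Z b -> count_mem (- j%:Z) a = count_mem (- j%:Z) b ->
  zeta_tail j k a = zeta_tail j k b ->
  forall i, (j <= i < j + k)%N ->
    reading_word i%:Z (i%:Z + 1) a = reading_word i%:Z (i%:Z + 1) b /\
    reading_word (- i%:Z) (- i%:Z - 1) a = reading_word (- i%:Z) (- i%:Z - 1) b.
Proof.
move=> ha hb; elim: k j => [|k IH] j cp cm /= e i; first by lia.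
move: e; rewrite !rev_zeta_block -!catA.
case/cat_cancel_Ns; rewrite ?Ns_reading_word //.
- by apply: startsE_cat; [apply: startsE_Sminus | apply: startsE_zeta_tail].
- by apply: startsE_cat; [apply: startsE_Sminus | apply: startsE_zeta_tail].
move=> ep; case/cat_cancel_Ns; rewrite ?Ns_reading_word ?count_rev //.
- exact: startsE_zeta_tail.
- exact: startsE_zeta_tail.
rewrite -!rev_reading_word => /(can_inj revK) em et.
move=> hi; have [->|ij] := eqVneq i j; first by [].
apply: (IH j.+1) => //; last by lia.
- move/(congr1 Es): ep; rewrite !Es_reading_word; try lia.
  by have -> : j.+1%:Z = j%:Z + 1 by lia.
- move/(congr1 Es): em; rewrite !Es_reading_word; try lia.
  by have -> : - j.+1%:Z = - j%:Z - 1 by lia.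
Qed.

Lemma zeta_blocks_inj n a b : area_seq a -> area_seq b ->
  all (fun v => `|v| <= n)%N a -> all (fun v => `|v| <= n)%N b ->
  size a = size b -> zeta_blocks n.+1 a = zeta_blocks n.+1 b -> a = b.
Proof.
move=> ha hb na nb sab e.
have small c : all (fun v => `|v| <= n)%N c ->
    count (fun v => `|v| <= n.+1)%N c = size c.
  by move=> hc; apply/eqP; rewrite -all_count; apply: sub_all hc => v; lia.
have c0 : count_mem 0 a = count_mem 0 b.
  have := Es_zeta_blocks n.+1 a; rewrite e.
  have := Es_zeta_blocks n.+1 b.
  rewrite (small _ na).
  rewrite (small _ nb).
  have E c : abs_count 0 c = count_mem 0 c by apply: eq_count => v /=; lia.
  by rewrite !E; lia.
have [/andP[pa _] /andP[pb _]] := (ha, hb).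
apply: reading_word_inj pa pb _.
have := @zeta_tail_inj 0 n.+1 a b ha hb c0.
rewrite oppr0 -!rev_zeta_blocks e => /(_ c0 erefl) H.
(* The value [v = - n - 1] is left out, as its reading still sees the entries [- n]. *)
have empty c (v : int) : all (fun u => `|u| <= n)%N c -> (v < - n%:Z - 1) || (n%:Z < v) ->
    reading_word v (v + 1) c = [::].
  move=> + hv; elim: c => //= z c IH /andP[zn /IH ->].
  by case: eqP => [|_]; [lia|case: eqP => //; lia].
move=> v; have [hv|hv] := boolP ((v < - n%:Z - 1) || (n%:Z < v)).
  by rewrite !empty.
have [v0|v0] := leP (0 : int) v.
  have -> : v = `|v|%N%:Z by lia.
  by case: (H `|v|%N) => //; lia.
(* For [v < 0], the minus reading of block [- v - 1] reads [v + 1] and [v], with the letters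
   exchanged. *)
apply: reading_word_swap; first by lia.
have [] := H (absz (v + 1)); first by lia.
have -> : - (absz (v + 1))%:Z = v + 1 by lia.
by rewrite addrK.
Qed.

(* Bijectivity on lattice paths *)
Local Close Scope ring_scope.

Lemma heights_abs_bound n w :
  lattice_paths n n w -> all (fun v => `|v|%N <= n) (heights 0 w).
Proof. by move=> [we wn]; apply/allP => v /heights_bounds; lia. Qed.

Lemma zetaC_ballot n w : lattice_paths n n w -> ballot_paths (2 * n) (zetaC n w).
Proof.
move=> hw; have [we wn] := hw; rewrite zetaC_heights //.
have hb m : n <= m -> count (fun v => `|v|%N <= m) (heights 0%R w) = n.
  move=> nm; rewrite -[RHS]wn -(size_heights 0%R); apply/eqP; rewrite -all_count.
  by apply: sub_all (heights_abs_bound hw) => v; lia.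
split.
  have := Es_zeta_blocks n.+1 (heights 0%R w).
  by rewrite size_word Ns_zeta_blocks !hb //; lia.
(* No entry has absolute value [n + 1], so block [n], which comes first, has no East step and can
   start at height 0. *)
apply/(ballot_fromP 0)/ballot_zeta_blocks; rewrite leqNgt -has_count.
by apply/hasPn => v /(allP (heights_abs_bound hw)); lia.
Qed.

Lemma zetaC_inj n w w' : lattice_paths n n w -> lattice_paths n n w' ->
  zetaC n w = zetaC n w' -> w = w'.
Proof.
have area u : lattice_paths n n u -> area_seq (heights 0%R u).
  move=> [ue un]; rewrite /area_seq path_heights //=.
  by have := last_heights u (lexx (0%R : int)); lia.
move=> hw hw'; have [[we wn] [we' wn']] := (hw, hw').
rewrite !zetaC_heights // => e.
apply: (@heights_inj 0%R); first by rewrite we we'.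
apply: zeta_blocks_inj e; rewrite ?size_heights ?wn ?wn' //; try exact: area;
  exact: heights_abs_bound.
Qed.

Theorem theorem4p17 (n : nat) (n_gt0 : 0 < n) :
  set_bij (lattice_paths n n) (ballot_paths (2 * n)) (zetaC n).
Proof.
split=> [w hw||z /mem_ballot_seq hz].
- exact: zetaC_ballot.
- by move=> w w' /set_mem hw /set_mem hw'; apply: zetaC_inj.
pose s := map (zetaC n) (balanced_seq n).
have us : uniq s.
  rewrite map_inj_in_uniq ?filter_uniq ?uniq_words //.
  by move=> w w' /mem_balanced_seq hw /mem_balanced_seq; apply: zetaC_inj.
have sub : {subset s <= ballot_seq n}.
  by move=> _ /mapP[w /mem_balanced_seq hw ->]; apply/mem_ballot_seq/zetaC_ballot.
have [] := uniq_min_size us sub; first by rewrite size_map size_ballot_seq.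
by move=> _ /(_ z); rewrite hz => /mapP[w /mem_balanced_seq hw ->]; exists w.
Qed.
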